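(* Let $\mathcal M$ be a class of models, let $M\in\mathcal M$ be a model, let $e_0$ be the all-zero example over the features of $M$, and let $c=M(e_0)$. The following statements are equivalent: (1) $M$ is a no-instance of $\mathcal M\text{-}\mathrm{HOM}$. (2) The empty set is a solution for the instance $(M,e_0)$ of $\mathcal M\text{-}\mathrm{lAXp}_{\subseteq}$. (3) $(M,e_0)$ is a no-instance of $\mathcal M\text{-}\mathrm{lCXp}_{\subseteq}$ (i.e. there is no local contrastive explanation for $e_0$ w.r.t. $M$). (4) The empty set (empty partial example) is a solution for the instance $(M,c)$ of $\mathcal M\text{-}\mathrm{gAXp}_{\subseteq}$. (5) The empty set (empty partial example) is a solution for the instance $(M,1-c)$ of $\mathcal M\text{-}\mathrm{gCXp}_{\subseteq}$. (6) $(M,e_0,0)$ is a yes-instance of $\mathcal M\text{-}\mathrm{lAXp}_{|\cdot|}$. (7) For every integer $k$, $(M,e_0,k)$ is a no-instance of $\mathcal M\text{-}\mathrm{lCXp}_{|\cdot|}$. (8) $(M,c,0)$ is a yes-instance of $\mathcal M\text{-}\mathrm{gAXp}_{|\cdot|}$. (9) $(M,1-c,0)$ is a yes-instance of $\mathcal M\text{-}\mathrm{gCXp}_{|\cdot|}$.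
   Context: A model $M$ over a finite set $F(M)$ of binary features represents a function from examples $e:F(M)\to\{0,1\}$ to $\{0,1\}$. The all-zero example $e_0$ is $0$ on every feature. $\mathcal M\text{-}\mathrm{HOM}$: given $M\in\mathcal M$, is there an example $e$ with $M(e)\neq M(e_0)$? Explanations. For a model $M$, an example $e$ and a class $c'\in\{0,1\}$: (lAXp) a local abductive explanation for $e$ is a set $A\subseteq F(M)$ such that $M(e')=M(e)$ for every example $e'$ agreeing with $e$ on $A$; (lCXp) a local contrastive explanation for $e$ is a set $A\subseteq F(M)$ such that some example $e'$ with $M(e')\ne M(e)$ differs from $e$ only on features in $A$; (gAXp) a global abductive explanation for $c'$ is a partial assignment $\tau:F'\to\{0,1\}$, $F'\subseteq F(M)$, such that $M(e)=c'$ for every example $e$ agreeing with $\tau$; (gCXp) a global contrastive explanation for $c'$ is a partial assignment $\tau:F'\to\{0,1\}$, $F'\subseteq F(M)$, such that $M(e)\neq c'$ for every example $e$ agreeing with $\tau$. The size of an explanation is $|A|$, respectively $|F'|$. For $X$ one of these types: $\mathcal M\text{-}X_{\subseteq}$ is the search problem with input $M\in\mathcal M$ and an example $e$ (local) or class $c'$ (global), asking for an inclusion-minimal explanation of type $X$ (an instance is a no-instance if no explanation exists); $\mathcal M\text{-}X_{|\cdot|}$ additionally has an integer $k$ as input and asks whether an explanation of type $X$ of size at most $k$ exists. *)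

(* Defs.v *)
From mathcomp Require Import all_boot all_order all_algebra.

Set Implicit Arguments.
Unset Strict Implicit.
Unset Printing Implicit Defensive.

(* A class of models is a type of representations, each with its own finite   *)
(* feature set and the function it represents; distinct models may represent  *)
(* the same function.                                                         *)
Record model_class := ModelClass {
  model :> Type;
  features : model -> finType;
  classify : forall M : model, {ffun features M -> bool} -> bool
}.

Section Explanations.
Variable C : model_class.
Implicit Type M : C.

Definition example M : Type := {ffun features M -> bool}.

Definition zero_example M : example M := [ffun=> false].

(* The finite map t stands for tau : F' -> {0,1} with F' the set of features  *)
(* not sent to None.                                                          *)
Definition partial_example M : Type := {ffun features M -> option bool}.

Definition pdom M (t : partial_example M) : {set features M} :=
  [set f | t f != None].

Definition empty_partial M : partial_example M := [ffun=> None].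

Definition pincl M (t1 t2 : partial_example M) : Prop :=
  forall f b, t1 f = Some b -> t2 f = Some b.

Definition agrees M (e : example M) (t : partial_example M) : Prop :=
  forall f b, t f = Some b -> e f = b.

Definition HOM M : Prop :=
  exists e : example M, classify e <> classify (zero_example M).

Definition is_lAXp M (e : example M) (A : {set features M}) : Prop :=
  forall e' : example M, {in A, e' =1 e} -> classify e' = classify e.

Definition is_lCXp M (e : example M) (A : {set features M}) : Prop :=
  exists2 e' : example M,
    classify e' <> classify e & forall f, e' f <> e f -> f \in A.

Definition is_gAXp M (c : bool) (t : partial_example M) : Prop :=
  forall e : example M, agrees e t -> classify e = c.

Definition is_gCXp M (c : bool) (t : partial_example M) : Prop :=
  forall e : example M, agrees e t -> classify e <> c.

End Explanations.

(* A type X of explanations: the data given with a model (an example or a     *)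
(* class), the candidate explanations with their inclusion order and size,    *)
(* and which candidates are explanations.                                     *)
Record explanation_type (C : model_class) := ExplanationType {
  query : C -> Type;
  candidate : C -> Type;
  included : forall M, candidate M -> candidate M -> Prop;
  expl_size : forall M, candidate M -> nat;
  explains : forall M, query M -> candidate M -> Prop
}.

Definition lAXp (C : model_class) : explanation_type C :=
  @ExplanationType C (@example C) (fun M => {set features M})
    (fun M A B => A \subset B) (fun M A => #|A|) (@is_lAXp C).

Definition lCXp (C : model_class) : explanation_type C :=
  @ExplanationType C (@example C) (fun M => {set features M})
    (fun M A B => A \subset B) (fun M A => #|A|) (@is_lCXp C).

Definition gAXp (C : model_class) : explanation_type C :=
  @ExplanationType C (fun=> bool) (@partial_example C)
    (@pincl C) (fun M t => #|pdom t|) (@is_gAXp C).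

Definition gCXp (C : model_class) : explanation_type C :=
  @ExplanationType C (fun=> bool) (@partial_example C)
    (@pincl C) (fun M t => #|pdom t|) (@is_gCXp C).

Section Problems.
Variables (C : model_class) (X : explanation_type C).

Definition subset_solution (M : C) (q : query X M) (a : candidate X M) : Prop :=
  explains q a /\
  forall b : candidate X M, explains q b -> included b a -> b = a.

(* No explanation at all, minimal or not.                                     *)
Definition subset_no_instance (M : C) (q : query X M) : Prop :=
  ~ exists a : candidate X M, explains q a.

Definition card_yes_instance (M : C) (q : query X M) (k : int) : Prop :=
  exists2 a : candidate X M, explains q a & ((expl_size a)%:Z <= k)%R.

Definition card_no_instance (M : C) (q : query X M) (k : int) : Prop :=
  ~ card_yes_instance q k.

End Problems.

Arguments subset_solution {C} X M q a.
Arguments subset_no_instance {C} X M q.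
Arguments card_yes_instance {C} X M q k.
Arguments card_no_instance {C} X M q k.

(* Main.v *)
Require Import Defs.
From mathcomp Require Import all_boot all_order all_algebra.

(** Each of the nine statements says that the model is constant. With nothing
    fixed, every example is a competitor, so the empty set is an abductive
    explanation exactly when the model is constant; being the only candidate
    of size 0 and included in all others, it is then automatically minimal.
    Dually, the set of all features is a contrastive explanation as soon as
    one exists. *)

Section MinimalCandidate.
Context {C : model_class} (X : explanation_type C) (M : C).
Implicit Types (q : query X M) (a b : candidate X M).

(** With nothing else below [a], minimality is automatic and only the explanation condition is
    left. *)
Lemma subset_solution_least q a :
  (forall b, included b a -> b = a) ->
  subset_solution X M q a <-> explains q a.
Proof. by move=> least_a; split=> [[]|] //; split=> // b _; exact: least_a. Qed.

(** The bound 0 leaves [a] as the only possible witness. *)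
Lemma card_yes_instance0 q a :
  (forall b, expl_size b = 0 <-> b = a) ->
  card_yes_instance X M q 0%Z <-> explains q a.
Proof.
move=> size0; split=> [[b qb]|qa]; last by exists a => //; rewrite (size0 a).2.
by rewrite lez_nat leqn0 => /eqP /size0 <-.
Qed.

End MinimalCandidate.

Section ConstantModel.
Context {C : model_class} (M : C).
Implicit Types (e : example M) (t : partial_example M) (c : bool).

(** The value is a parameter, so that local statements, with value [classify e], and global ones,
    with a given class, meet in one proposition. *)
Definition constant_model c := forall e, classify e = c.

Lemma agrees_empty e : agrees e (empty_partial M).
Proof. by move=> f b; rewrite ffunE. Qed.

Lemma pincl_empty t : pincl t (empty_partial M) -> t = empty_partial M.
Proof.
move=> t_incl; apply/ffunP=> f; rewrite ffunE.
by case tf: (t f) => [b|] //; have := t_incl f b tf; rewrite ffunE.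
Qed.

Lemma card_pdom_eq0 t : #|pdom t| = 0 <-> t = empty_partial M.
Proof.
split=> [/cards0_eq pdom0|->].
  (* The double negation exposes [t f != None], that is, membership of [f] in the empty domain. *)
  apply/ffunP=> f; rewrite ffunE; apply/eqP/negPn.
  by have := in_set0 f; rewrite -pdom0 inE => ->.
by apply/eqP; rewrite cards_eq0; apply/eqP/setP=> f; rewrite !inE ffunE.
Qed.

Lemma not_HOM_constant : ~ HOM M <-> constant_model (classify (zero_example M)).
Proof.
split=> [nHOM e|cst [e]]; last exact.
by apply/eqP/negPn/negP=> /eqP ne; apply: nHOM; exists e.
Qed.

Lemma is_lAXp_set0 e : is_lAXp e set0 <-> constant_model (classify e).
Proof. by split=> cst e' => [|_]; apply: cst => // f; rewrite inE. Qed.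

(** Contrastive explanations are closed under supersets, so [setT] can stand for all of them. *)
Lemma is_lCXp_setT e A : is_lCXp e A -> is_lCXp e setT.
Proof. by case=> e' ne _; exists e' => // f _; rewrite inE. Qed.

Lemma not_is_lCXp_setT e : ~ is_lCXp e setT <-> constant_model (classify e).
Proof.
split=> [nCXp e'|cst [e']]; last by rewrite cst.
by apply/eqP/negPn/negP=> /eqP ne; apply: nCXp; exists e' => // f; rewrite inE.
Qed.

Lemma is_gAXp_empty c : is_gAXp c (empty_partial M) <-> constant_model c.
Proof. by split=> cst e => [|_]; apply: cst; exact: agrees_empty. Qed.

(** There are only two classes, so avoiding [~~ c] amounts to taking the value [c]. *)
Lemma is_gCXp_empty c : is_gCXp (~~ c) (empty_partial M) <-> constant_model c.
Proof.
split=> [cst e|cst e _]; last by rewrite cst; case: c {cst}.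
by have := cst e (agrees_empty e); case: (classify e); case: c {cst}.
Qed.

Lemma subset_lAXp_constant e :
  subset_solution (lAXp C) M e (set0 : {set features M}) <->
  constant_model (classify e).
Proof.
apply: (iff_trans _ (is_lAXp_set0 e)); apply: subset_solution_least => A /=.
by rewrite subset0 => /eqP.
Qed.

Lemma subset_lCXp_constant e :
  subset_no_instance (lCXp C) M e <-> constant_model (classify e).
Proof.
apply: (iff_trans _ (not_is_lCXp_setT e)); split=> [nCXp eT|nCXp].
  by apply: nCXp; exists setT.
by case=> A /is_lCXp_setT.
Qed.

Lemma subset_gAXp_constant c :
  subset_solution (gAXp C) M c (empty_partial M) <-> constant_model c.
Proof.
by apply: (iff_trans _ (is_gAXp_empty c)); apply: subset_solution_least => t; exact: pincl_empty.
Qed.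

Lemma subset_gCXp_constant c :
  subset_solution (gCXp C) M (~~ c) (empty_partial M) <-> constant_model c.
Proof.
by apply: (iff_trans _ (is_gCXp_empty c)); apply: subset_solution_least => t; exact: pincl_empty.
Qed.

Lemma card_lAXp_constant e :
  card_yes_instance (lAXp C) M e 0%Z <-> constant_model (classify e).
Proof.
apply: (iff_trans _ (is_lAXp_set0 e)); apply: card_yes_instance0 => A /=.
by split=> [/cards0_eq|->] //; rewrite cards0.
Qed.

Lemma card_lCXp_constant e :
  (forall k : int, card_no_instance (lCXp C) M e k) <->
  constant_model (classify e).
Proof.
apply: (iff_trans _ (not_is_lCXp_setT e)); split=> [nCXp eT|nCXp k [A /is_lCXp_setT]] //.
(* The number of features is the size of [setT], so this bound excludes no candidate. *)
by apply: (nCXp #|features M|); exists setT; rewrite //= cardsT.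
Qed.

Lemma card_gAXp_constant c :
  card_yes_instance (gAXp C) M c 0%Z <-> constant_model c.
Proof.
by apply: (iff_trans _ (is_gAXp_empty c)); apply: card_yes_instance0 => t; exact: card_pdom_eq0.
Qed.

Lemma card_gCXp_constant c :
  card_yes_instance (gCXp C) M (~~ c) 0%Z <-> constant_model c.
Proof.
by apply: (iff_trans _ (is_gCXp_empty c)); apply: card_yes_instance0 => t; exact: card_pdom_eq0.
Qed.

End ConstantModel.

Theorem lemma19 (C : model_class) (M : C) :
  let e0 := zero_example M in
  let c := classify e0 in
  [<-> ~ HOM M;
       subset_solution (lAXp C) M e0 (set0 : {set features M});
       subset_no_instance (lCXp C) M e0;
       subset_solution (gAXp C) M c (empty_partial M);
       subset_solution (gCXp C) M (~~ c) (empty_partial M);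
       card_yes_instance (lAXp C) M e0 0%Z;
       forall k : int, card_no_instance (lCXp C) M e0 k;
       card_yes_instance (gAXp C) M c 0%Z;
       card_yes_instance (gCXp C) M (~~ c) 0%Z].
Proof.
(* A cycle of nine implications, each passing through [constant_model c]; the local lemmas apply at
   [e0] because [c] is [classify e0]. *)
move=> e0 c; tfae.
- by move=> /not_HOM_constant/subset_lAXp_constant.
- by move=> /subset_lAXp_constant/subset_lCXp_constant.
- by move=> /subset_lCXp_constant/subset_gAXp_constant.
- by move=> /subset_gAXp_constant/subset_gCXp_constant.
- by move=> /subset_gCXp_constant/card_lAXp_constant.
- by move=> /card_lAXp_constant/card_lCXp_constant.
- by move=> /card_lCXp_constant/card_gAXp_constant.
- by move=> /card_gAXp_constant/card_gCXp_constant.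
- by move=> /card_gCXp_constant/not_HOM_constant.
Qed.
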